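(* Let $E$ be a real Banach space which is uniformly convex with modulus $\delta_E$, and let $d>0$. Let $A\subset E$ be a closed set which is weakly convex with modulus of nonconvexity $\gamma_A(\varepsilon)$, $\varepsilon\in[0,2d)$, with $d\,\delta_E(\varepsilon/d)>\gamma_A(\varepsilon)$ for all $\varepsilon\in(0,2d)$, and suppose condition (i) holds for $\delta(t)=d\,\delta_E(t/d)$ and $\gamma=\gamma_A$. Let $d_1\in(0,d)$. Then for every $x\in E$, the set $A\cap B_{d_1}(x)$, if nonempty, is weakly convex with modulus of nonconvexity $\gamma_{A\cap B_{d_1}(x)}(\varepsilon)\le\gamma_A(\varepsilon)$ for $\varepsilon\in[0,\operatorname{diam}(A\cap B_{d_1}(x)))$, and it is path connected.
   Context: $B_r(a)$ is the closed ball. $\delta_E(\varepsilon)=\sup\{\delta\ge0: B_\delta(\frac{x_1+x_2}{2})\subset B_1(0)\ \forall x_1,x_2\in B_1(0),\ \|x_1-x_2\|=\varepsilon\}$ on $[0,2)$; $E$ uniformly convex means $\delta_E>0$ on $(0,2)$. For a closed set $S$ and $\varepsilon>0$, $\gamma^0_S(\varepsilon)=\inf\{\gamma>0: B_\gamma(\frac{x_1+x_2}{2})\cap S\ne\emptyset\ \forall x_1,x_2\in S,\ \|x_1-x_2\|\le\varepsilon\}$; modulus of nonconvexity $\gamma_S(0)=0$, $\gamma_S(\varepsilon)=\lim_{\tau\downarrow\varepsilon}\gamma^0_S(\tau)$. $S$ is weakly convex with modulus $\gamma_S$ on $[0,d')$ if $\gamma_S(\varepsilon)<\varepsilon/2$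 for $\varepsilon\in(0,d')$. Condition (i) for moduli $\delta,\gamma$: there is $s_0>0$ such that for every $s\in(0,s_0]$: (1) there is $t_s>s$ with $\delta(t_s-s)=\gamma(t_s)$; (2) $t\mapsto\delta(t-s)-\gamma(t)$ is positive and increasing for $t>t_s$; (3) there is $t(s)>t_s$ with $\delta(t(s)-s)-\gamma(t(s))=s/2$. *)

(* Defs.v *)
From HB Require Import structures.
From mathcomp Require Import all_boot all_order all_algebra.
From mathcomp Require Import all_classical all_reals all_analysis.
Set Implicit Arguments. Unset Strict Implicit. Unset Printing Implicit Defensive.
Import Order.TTheory GRing.Theory Num.Theory.
Import numFieldNormedType.Exports.
Local Open Scope classical_set_scope.
Local Open Scope ring_scope.

Section Defs.
Context {R : realType} {E : normedModType R}.

Definition cball (a : E) (r : R) : set E := [set x | `|x - a| <= r].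

Definition midp (x1 x2 : E) : E := 2^-1 *: (x1 + x2).

Definition modconv (eps : R) : R :=
  sup [set del : R | 0 <= del /\
        forall x1 x2 : E, x1 \in cball 0 1 -> x2 \in cball 0 1 ->
          `|x1 - x2| = eps -> cball (midp x1 x2) del `<=` cball 0 1].

Definition unif_convex : Prop := forall eps : R, 0 < eps < 2 -> 0 < modconv eps.

Definition gamma0 (S : set E) (eps : R) : R :=
  inf [set gam : R | 0 < gam /\
        forall x1 x2 : E, S x1 -> S x2 -> `|x1 - x2| <= eps ->
          cball (midp x1 x2) gam `&` S !=set0].

Definition gammaS (S : set E) (eps : R) : R :=
  if eps == 0 then 0 else lim (gamma0 S @ eps^'+).

Definition weakly_convex_on (S : set E) (d' : R) : Prop :=
  forall eps : R, 0 < eps < d' -> gammaS S eps < eps / 2.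

Definition diam (S : set E) : R := sup [set `|x - y| | x in S & y in S].

Definition path_connected_set (S : set E) : Prop :=
  forall x y : E, S x -> S y ->
    exists f : R -> E, {within `[0, 1], continuous f} /\ f 0 = x /\ f 1 = y /\
      f @` `[0, 1] `<=` S.

End Defs.

(* Condition (i) for moduli delta, gamma, considered on their common domain (0, D)
   (here D = 2d, the domain of gamma_A). *)
Definition condition_i {R : realType} (delta gamma : R -> R) (D : R) : Prop :=
  exists s0 : R, 0 < s0 /\ forall s : R, 0 < s <= s0 ->
    exists ts : R, s < ts < D /\ delta (ts - s) = gamma ts /\
      (forall t, ts < t < D -> 0 < delta (t - s) - gamma t) /\
      (forall t t', ts < t -> t < t' -> t' < D ->
         delta (t - s) - gamma t < delta (t' - s) - gamma t') /\
      (exists tt, ts < tt < D /\ delta (tt - s) - gamma tt = s / 2).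

(* Main.v *)
Require Import Defs.
From HB Require Import structures.
From mathcomp Require Import all_boot all_order all_algebra.
From mathcomp Require Import all_classical all_reals all_analysis.
From mathcomp Require Import ring lra.
Import Order.TTheory GRing.Theory Num.Theory.
Import numFieldNormedType.Exports.
Local Open Scope classical_set_scope.
Local Open Scope ring_scope.

(** Write [S] for the intersection of [A] with the ball of radius [d1].  That
    ball is the intersection of all balls of radius [d] centred at distance at
    most [d - d1] from its centre, so it contains the ball of radius
    [d * modconv (eps / d)] about the midpoint of any two of its points at
    distance [eps].  As [gammaS A eps] is smaller than this radius, the points
    of [A] near midpoints lie in [S], whence [gammaS S <= gammaS A].

    For paths, one wants a ratio [lam < 1] such that any [y], [z] in [S] have an
    approximate midpoint in [S] at distance at most [lam * |y - z|] from both;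
    repeated bisection then converges geometrically to a path.  In dimension at
    least two, averaging the second differences of the convex function
    [t |-> |y + t v|] gives [modconv eps <= eps / 4] for small [eps], hence
    [lam = 3/4] at small scales; [gammaS S eps < eps / 2] and right continuity
    extend this to all scales.  In dimension one, [A] has no short gaps. *)

(** * Midpoints and the modulus of nonconvexity *)

Section ModulusOfNonconvexity.
Context {R : realType} {E : normedModType R}.
Implicit Types (S : set E) (x y z : E).

Lemma midpC x y : midp x y = midp y x.
Proof. by rewrite /midp addrC. Qed.

Lemma midpxx x : midp x x = x.
Proof. by rewrite /midp -mulr2n -[x *+ 2]scaler_nat scalerA mulVf ?scale1r. Qed.

Lemma sub_midp x y z : z - midp x y = 2^-1 *: (z - x) + 2^-1 *: (z - y).
Proof.
by rewrite /midp -scalerDr addrACA -opprD scalerBr -[_ *: (z + z)]/(midp z z) midpxx.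
Qed.

Lemma distl_midp x y : `|x - midp x y| = `|x - y| / 2.
Proof.
by rewrite sub_midp subrr scaler0 add0r normrZ gtr0_norm ?invr_gt0// mulrC.
Qed.

Lemma distr_midp x y : `|y - midp x y| = `|x - y| / 2.
Proof. by rewrite midpC distl_midp distrC. Qed.

Lemma dist_near_midp x y z (g : R) : `|z - midp x y| <= g ->
  `|z - x| <= `|x - y| / 2 + g /\ `|z - y| <= `|x - y| / 2 + g.
Proof.
move=> zg; split.
  have := ler_distD (midp x y) z x.
  by rewrite [X in _ <= _ + X]distrC distl_midp; lra.
have := ler_distD (midp x y) z y.
by rewrite [X in _ <= _ + X]distrC distr_midp; lra.
Qed.

Let gams S (eps : R) := [set gam : R | 0 < gam /\
  forall x1 x2 : E, S x1 -> S x2 -> `|x1 - x2| <= eps ->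
    cball (midp x1 x2) gam `&` S !=set0].

Lemma gams_nonempty S (eps : R) : gams S eps !=set0.
Proof.
(* An endpoint is within [eps / 2] of the midpoint; the 1 keeps the radius positive when
   [eps <= 0]. *)
exists (Num.max 1 (eps / 2)); split => [|x y Sx Sy xy]; first by rewrite lt_max ltr01.
exists x; split => //; rewrite /cball /= distl_midp le_max; apply/orP; right; lra.
Qed.

Lemma gams_has_lbound S (eps : R) : has_lbound (gams S eps).
Proof. by exists 0 => g [/ltW]. Qed.

Lemma gamma0_ge0 S (eps : R) : 0 <= gamma0 S eps.
Proof. by apply: lb_le_inf; [exact: gams_nonempty|move=> g [/ltW]]. Qed.

Lemma gamma0_mono S : {homo gamma0 S : a b / a <= b}.
Proof.
move=> a b ab; apply: lb_le_inf; first exact: gams_nonempty.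
move=> g [g0 gP]; apply: ge_inf; first exact: gams_has_lbound.
by split => // x y Sx Sy xy; apply: gP => //; exact: le_trans ab.
Qed.

Lemma gamma0_ltP S (eps g : R) x y : gamma0 S eps < g -> S x -> S y ->
  `|x - y| <= eps -> exists2 z, S z & `|z - midp x y| <= g.
Proof.
move=> /(inf_lt (gams_nonempty S eps))[h [h0 hP] hg] Sx Sy xy.
have [z [zh Sz]] := hP _ _ Sx Sy xy.
by exists z => //; exact: le_trans (ltW hg).
Qed.

Lemma gamma0_le (S T : set E) (eps : R) :
  (forall g x y, 0 < g -> S x -> S y ->
     `|x - y| <= eps ->
     (forall x1 x2, T x1 -> T x2 -> `|x1 - x2| <= eps ->
        cball (midp x1 x2) g `&` T !=set0) ->
     cball (midp x y) g `&` S !=set0) ->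
  gamma0 S eps <= gamma0 T eps.
Proof.
move=> ST; apply: lb_le_inf; first exact: gams_nonempty.
move=> g [g0 gP]; apply: ge_inf; first exact: gams_has_lbound.
by split => // x y Sx Sy xy; exact: ST.
Qed.

(** Monotone and bounded below, [gamma0 S] has a right limit, which is its infimum over any right
    window; length 1 is arbitrary. *)
Lemma gamma0_cvg_right S (eps : R) :
  gamma0 S t @[t --> eps^'+] -->
    inf [set gamma0 S t | t in [set` `]eps, (eps + 1)[%R]].
Proof.
apply: nondecreasing_at_right_cvgr; first by rewrite bnd_simp ltrDl.
  by move=> a b _ _; exact: gamma0_mono.
by exists 0 => _ [t _ <-]; exact: gamma0_ge0.
Qed.

Lemma gammaSE S (eps : R) : eps != 0 ->
  gammaS S eps = inf [set gamma0 S t | t in [set` `]eps, (eps + 1)[%R]].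
Proof.
by move=> /negPf e0; rewrite /gammaS e0; exact/cvg_lim/gamma0_cvg_right.
Qed.

Lemma gamma0_le_gammaS S (eps : R) : eps != 0 -> gamma0 S eps <= gammaS S eps.
Proof.
move=> e0; rewrite gammaSE//; apply: lb_le_inf => [|_ [t + <-]].
  exists (gamma0 S (eps + 1/2)), (eps + 1/2) => //=.
  by rewrite in_itv /=; lra.
rewrite /= in_itv /= => /andP[et _].
exact/gamma0_mono/ltW.
Qed.

Lemma gammaS_ltP S (eps g e : R) : eps != 0 -> 0 < e -> gammaS S eps < g ->
  exists2 r, eps < r < eps + e & gamma0 S r < g.
Proof.
move=> e0 e_gt0; rewrite gammaSE// => /inf_lt[|_ [t + <-]].
  exists (gamma0 S (eps + 1/2)), (eps + 1/2) => //=.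
  by rewrite in_itv /=; lra.
rewrite /= in_itv /= => /andP[et _] tg.
(* Moving the point left to stay below [eps + e] only lowers [gamma0]. *)
exists (Num.min t (eps + e / 2)).
  by rewrite lt_min et /= gt_min; apply/andP; split; [|apply/orP; right]; lra.
by apply: le_lt_trans tg; apply: gamma0_mono; rewrite ge_min lexx.
Qed.

Lemma gammaS_le (S T : set E) (eps : R) :
  (forall t, gamma0 S t <= gamma0 T t) -> gammaS S eps <= gammaS T eps.
Proof.
move=> ST; rewrite /gammaS; case: ifP => // _.
apply: (@ler_lim _ eps^'+ _ _ (gamma0 S) (gamma0 T)).
- by apply/cvg_ex; eexists; exact: gamma0_cvg_right.
- by apply/cvg_ex; eexists; exact: gamma0_cvg_right.
- exact: nearW.
Qed.

Lemma diam_le S (b : R) : S !=set0 ->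
  (forall x y, S x -> S y -> `|x - y| <= b) -> diam S <= b.
Proof.
move=> [x Sx] Sb; apply: ge_sup.
  by exists `|x - x|, x => //; exists x.
by move=> _ [y Sy [z Sz <-]]; exact: Sb.
Qed.

End ModulusOfNonconvexity.

(** * Paths by repeated bisection *)

Section PathsFromMidpoints.
Context {R : realType} {E : completeNormedModType R}.
Variables (S : set E) (lam : R) (m : E -> E -> E).
Hypotheses (clS : closed S) (lam_ge0 : 0 <= lam) (lam_lt1 : lam < 1).
Hypothesis mP : forall x y, S x -> S y ->
  [/\ S (m x y), `|m x y - x| <= lam * `|x - y| & `|m x y - y| <= lam * `|x - y|].
Implicit Types (x y : E) (s t : R) (n : nat).

(** For [t] in [0, 1]: after [n] bisections, the left endpoint of the piece whose dyadic interval
    contains [t]; the parameter 1/2 goes to the left half. *)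
Fixpoint bisect_left n x y t : E :=
  if n is n'.+1 then
    if t <= 2^-1 then bisect_left n' x (m x y) (2 * t)
    else bisect_left n' (m x y) y (2 * t - 1)
  else x.

Definition bisect x y t : E := limn (fun n => bisect_left n x y t).

Lemma bisect_left_in n x y t : S x -> S y -> S (bisect_left n x y t).
Proof.
elim: n x y t => //= n IHn x y t Sx Sy; have [Sm _ _] := mP _ _ Sx Sy.
by case: ifP => _; exact: IHn.
Qed.

(** Pieces at depth [n] have length at most [lam ^ n] times the original, and the next left endpoint
    moves within its piece. *)
Lemma dist_bisect_left n x y t : S x -> S y ->
  `|bisect_left n.+1 x y t - bisect_left n x y t| <= `|x - y| * lam ^+ n.
Proof.
elim: n x y t => [|n IHn] x y t Sx Sy; have [Sm mx my] := mP _ _ Sx Sy.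
  rewrite /= expr0 mulr1; case: ifP => _; first by rewrite subrr normr0.
  by rewrite (le_trans mx)// ler_piMl// ltW.
have step a b : S a -> S b -> `|a - b| <= lam * `|x - y| -> forall u,
    `|bisect_left n.+1 a b u - bisect_left n a b u| <= `|x - y| * lam ^+ n.+1.
  move=> Sa Sb ab u; apply: le_trans (IHn _ _ _ Sa Sb) _.
  by rewrite exprS mulrA ler_wpM2r ?exprn_ge0// [leRHS]mulrC.
have unf k : bisect_left k.+1 x y t = if t <= 2^-1 then bisect_left k x (m x y) (2 * t)
    else bisect_left k (m x y) y (2 * t - 1) by [].
rewrite 2!unf; case: ifP => _; apply: step => //.
by rewrite distrC.
Qed.

Lemma bisect_left_cvg x y t : S x -> S y ->
  bisect_left n x y t @[n --> \oo] --> bisect x y t.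
Proof.
move=> Sx Sy; rewrite /bisect.
set u := fun n => bisect_left n x y t.
suff: cvgn u by [].
(* The increments are dominated by a geometric series, so completeness gives convergence. *)
have -> : u = (fun n => u 0%N + series (telescope u) n).
  by apply/funext => n; rewrite -eq_sum_telescope.
apply: is_cvgD; first exact: is_cvg_cst.
apply: normed_cvg; apply: series_le_cvg; last first.
- apply: (@is_cvg_geometric_series _ `|x - y| lam).
  by rewrite ger0_norm.
- by move=> n; exact: dist_bisect_left.
- by move=> n; rewrite /geometric /= mulr_ge0// exprn_ge0.
- by move=> n; exact: normr_ge0.
Qed.

Lemma bisect_in x y t : S x -> S y -> S (bisect x y t).
Proof.
move=> Sx Sy; apply: (closed_cvg S clS _ _ (bisect_left_cvg x y t Sx Sy)).
by near=> n; exact: bisect_left_in.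
Unshelve. all: by end_near. Qed.

Let C : R := (1 - lam)^-1 + 1.

Let C_ge1 : 1 <= C.
Proof. by rewrite /C lerDr invr_ge0 subr_ge0 ltW. Qed.

Lemma dist_bisect_left0 n x y t : S x -> S y ->
  `|bisect_left n x y t - x| <= `|x - y| * (1 - lam)^-1.
Proof.
move=> Sx Sy.
(* The partial geometric sum is the form that passes through the induction. *)
suff : `|bisect_left n x y t - x| <= `|x - y| * ((1 - lam ^+ n) / (1 - lam)).
  move/le_trans; apply; rewrite ler_wpM2l// ler_piMl//.
    by rewrite invr_ge0 subr_ge0 ltW.
  by rewrite lerBlDr lerDl exprn_ge0.
elim: n => [|n IHn]; first by rewrite /= subrr normr0 expr0 subrr mul0r mulr0.
apply: le_trans (ler_distD (bisect_left n x y t) _ _) _.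
suff -> : (1 - lam ^+ n.+1) / (1 - lam) = lam ^+ n + (1 - lam ^+ n) / (1 - lam).
  by rewrite mulrDr lerD// dist_bisect_left.
by rewrite exprS; field; rewrite subr_eq0 gt_eqF.
Qed.

Lemma dist_bisectl x y t : S x -> S y -> `|bisect x y t - x| <= C * `|x - y|.
Proof.
move=> Sx Sy; apply: (@le_trans _ _ (`|x - y| * (1 - lam)^-1)); last first.
  by rewrite mulrC ler_wpM2r// /C lerDl.
apply: (cvgr_to_le (f := fun n => `|bisect_left n x y t - x|) (F := \oo)).
  apply: cvg_norm; apply: cvgB; first exact: bisect_left_cvg.
  exact: cvg_cst.
by near=> n; exact: dist_bisect_left0.
Unshelve. all: by end_near. Qed.

Lemma dist_bisectr x y t : S x -> S y -> `|bisect x y t - y| <= (C + 1) * `|x - y|.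
Proof.
move=> Sx Sy; have := ler_distD x (bisect x y t) y.
by have := dist_bisectl x y t Sx Sy; lra.
Qed.

Lemma bisect_lo x y t : S x -> S y -> t <= 2^-1 ->
  bisect x y t = bisect x (m x y) (2 * t).
Proof.
move=> Sx Sy t2; have [Sm _ _] := mP _ _ Sx Sy; apply: cvg_lim => //.
rewrite -cvg_shiftS /= t2; exact: bisect_left_cvg.
Qed.

Lemma bisect0 x y : bisect x y 0 = x.
Proof.
rewrite /bisect; suff -> : (fun n => bisect_left n x y 0) = fun=> x.
  by rewrite lim_cst.
apply/funext => n; elim: n y => //= n IHn y.
by rewrite invr_ge0 ler0n mulr0 IHn.
Qed.

Lemma bisect1 x y : S x -> S y -> bisect x y 1 = y.
Proof.
move=> Sx Sy; apply: cvg_lim => //.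
(* At [t = 1] the left endpoints only approach [y], at the rate at which the last piece shrinks. *)
have bnd n : `|y - bisect_left n x y 1| <= geometric `|x - y| lam n.
  rewrite /geometric /=; elim: n x Sx => [|n IHn] x Sx.
    by rewrite expr0 mulr1 distrC.
  have [Sm mx my] := mP _ _ Sx Sy.
  have -> : bisect_left n.+1 x y 1 = bisect_left n (m x y) y 1.
    rewrite /= ifF; first by congr bisect_left; lra.
    by apply/negbTE; rewrite -ltNge; lra.
  apply: le_trans (IHn _ Sm) _.
  by rewrite exprS mulrA ler_wpM2r ?exprn_ge0// [leRHS]mulrC.
apply/cvgrPdist_le => e e0.
have /cvgrPdist_le/(_ _ e0) : geometric `|x - y| lam n @[n --> \oo] --> 0.
  by apply: cvg_geometric; rewrite ger0_norm.
apply: filterS => n; rewrite sub0r normrN => h.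
by apply: le_trans (bnd n) _; apply: le_trans h; rewrite ler_norm.
Qed.

Lemma bisect_hi x y t : S x -> S y -> 2^-1 <= t ->
  bisect x y t = bisect (m x y) y (2 * t - 1).
Proof.
move=> Sx Sy; have [Sm _ _] := mP _ _ Sx Sy.
rewrite le_eqVlt => /predU1P[<-|t2].
  (* At [t = 1/2] the recursion goes left, but both halves take the value [m x y] there. *)
  by rewrite bisect_lo// mulfV// subrr bisect0 bisect1.
apply: cvg_lim => //; rewrite -cvg_shiftS /= leNgt t2 /=; exact: bisect_left_cvg.
Qed.

Lemma bisect_near0 n x y t : S x -> S y -> 0 <= t <= 2^-1 ^+ n ->
  `|bisect x y t - x| <= (C + 1) * lam ^+ n * `|x - y|.
Proof.
elim: n y t => [|n IHn] y t Sx Sy.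
  rewrite expr0 mulr1 => _; apply: le_trans (dist_bisectl x y t Sx Sy) _.
  by rewrite ler_wpM2r// lerDl.
rewrite !exprS => /andP[t0 tn]; have [Sm mx _] := mP _ _ Sx Sy.
have : 2^-1 ^+ n <= 1 :> R by rewrite exprn_ile1 ?invf_le1// ler1n.
move: (2^-1 ^+ n) tn IHn => q tn IHn n1; rewrite bisect_lo//; last by lra.
apply: le_trans (IHn _ _ Sx Sm _) _; first by lra.
rewrite (mulrC lam) -!mulrA; apply: ler_wpM2l.
  by have := C_ge1; lra.
by rewrite ler_wpM2l ?exprn_ge0// distrC.
Qed.

Lemma bisect_near1 n x y t : S x -> S y -> 0 <= 1 - t <= 2^-1 ^+ n ->
  `|bisect x y t - y| <= (C + 1) * lam ^+ n * `|x - y|.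
Proof.
elim: n x t => [|n IHn] x t Sx Sy.
  by rewrite expr0 mulr1 => _; exact: dist_bisectr.
rewrite !exprS => /andP[t0 tn]; have [Sm _ my] := mP _ _ Sx Sy.
have : 2^-1 ^+ n <= 1 :> R by rewrite exprn_ile1 ?invf_le1// ler1n.
move: (2^-1 ^+ n) tn IHn => q tn IHn n1; rewrite bisect_hi//; last by lra.
apply: le_trans (IHn _ _ Sm Sy _) _; first by lra.
rewrite (mulrC lam) -!mulrA; apply: ler_wpM2l.
  by have := C_ge1; lra.
by rewrite ler_wpM2l ?exprn_ge0.
Qed.

(** Parameters in the same half are rescaled, which doubles their gap and costs a factor [lam].
    Parameters on both sides of 1/2 are each compared with [m x y], whence the factor 2. *)
Lemma bisect_modulus n x y s t : S x -> S y -> 0 <= s -> s <= t -> t <= 1 ->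
  t - s <= 2^-1 ^+ n ->
  `|bisect x y s - bisect x y t| <= 2 * (C + 1) * lam ^+ n * `|x - y|.
Proof.
elim: n x y s t => [|n IHn] x y s t Sx Sy s0 st t1.
  rewrite expr0 mulr1 => _; have := ler_distD x (bisect x y s) (bisect x y t).
  rewrite [X in _ <= _ + X]distrC.
  have := dist_bisectl x y s Sx Sy; have := dist_bisectl x y t Sx Sy.
  by have := normr_ge0 (x - y); lra.
rewrite exprS; set q := 2^-1 ^+ n => tsn; have [Sm mx my] := mP _ _ Sx Sy.
have n0 : 0 <= lam ^+ n by rewrite exprn_ge0.
have shrink (D r : R) : 0 <= D -> r <= lam * `|x - y| ->
    D * lam ^+ n * r <= D * lam ^+ n.+1 * `|x - y|.
  move=> D0 rl; rewrite exprSr mulrA -[leRHS]mulrA.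
  by apply: ler_wpM2l => //; rewrite mulr_ge0.
have C0 : 0 <= C + 1 by have := C_ge1; lra.
have C20 : 0 <= 2 * (C + 1) by lra.
have [t2|t2] := leP t 2^-1.
  have s2 : s <= 2^-1 by lra.
  rewrite (bisect_lo x y s Sx Sy s2) (bisect_lo x y t Sx Sy t2).
  apply: le_trans (shrink _ `|x - m x y| C20 _); first by apply: IHn; rewrite // -/q; lra.
  by rewrite distrC.
have [s2|s2] := leP 2^-1 s.
  rewrite (bisect_hi x y s Sx Sy s2) (bisect_hi x y t Sx Sy (ltW t2)).
  by apply: le_trans (shrink _ `|m x y - y| C20 _) => //; apply: IHn; rewrite // -/q; lra.
rewrite (bisect_lo x y s Sx Sy (ltW s2)) (bisect_hi x y t Sx Sy (ltW t2)).
have := ler_distD (m x y) (bisect x (m x y) (2 * s)) (bisect (m x y) y (2 * t - 1)).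
rewrite [X in _ <= _ + X]distrC => tri.
have h1 : `|bisect x (m x y) (2 * s) - m x y| <= (C + 1) * lam ^+ n.+1 * `|x - y|.
  apply: le_trans (shrink _ `|x - m x y| C0 _); last by rewrite distrC.
  by apply: bisect_near1; rewrite // -/q; lra.
have h2 : `|bisect (m x y) y (2 * t - 1) - m x y| <= (C + 1) * lam ^+ n.+1 * `|x - y|.
  apply: le_trans (shrink _ `|m x y - y| C0 _) => //.
  by apply: bisect_near0; rewrite // -/q; lra.
by move: (lam ^+ n.+1) tri h1 h2 => l; lra.
Qed.

Lemma bisect_continuous x y : S x -> S y -> {within `[0, 1], continuous (bisect x y)}.
Proof.
move=> Sx Sy; apply/subspace_continuousP => s; rewrite /= in_itv /= => /andP[s0 s1].
apply/cvgrPdist_le => e e0.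
have /cvgrPdist_le/(_ _ e0) :
    geometric (2 * (C + 1) * `|x - y|) lam n @[n --> \oo] --> 0.
  by apply: cvg_geometric; rewrite ger0_norm.
move=> [N _ /(_ N (leqnn N))]; rewrite /geometric /= sub0r normrN.
move=> /(le_trans (ler_norm _)) bN.
have d0 : 0 < 2^-1 ^+ N :> R by rewrite exprn_gt0// invr_gt0.
apply/nbhs_ballP; exists (2^-1 ^+ N) => //= t; rewrite /ball /= => st.
rewrite in_itv /= => /andP[t0 t1].
have {st} : `|s - t| <= 2^-1 ^+ N := ltW st.
rewrite ler_norml => /andP[st1 st2].
apply: (le_trans _ bN); rewrite [leRHS]mulrAC.
have [st|/ltW ts] := leP s t; first by apply: bisect_modulus => //; lra.
by rewrite distrC; apply: bisect_modulus => //; lra.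
Qed.

End PathsFromMidpoints.

Lemma midpoints_path_connected {R : realType} {E : completeNormedModType R}
    (S : set E) (lam : R) :
  closed S -> 0 <= lam < 1 ->
  (forall x y, S x -> S y -> exists m,
     [/\ S m, `|m - x| <= lam * `|x - y| & `|m - y| <= lam * `|x - y|]) ->
  path_connected_set S.
Proof.
move=> clS /andP[l0 l1] Sm.
(* Choice needs a total function on pairs, so any point serves outside [S]. *)
have exm (p : E * E) : exists z, S p.1 -> S p.2 -> [/\ S z,
    `|z - p.1| <= lam * `|p.1 - p.2| & `|z - p.2| <= lam * `|p.1 - p.2|].
  have [[Sx Sy]|n] := pselect (S p.1 /\ S p.2).
    by have [z zP] := Sm _ _ Sx Sy; exists z.
  by exists p.1 => Sx Sy; exfalso; apply: n.
have [f fP] := choice exm.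
pose m x y := f (x, y).
have mP x y : S x -> S y -> [/\ S (m x y), `|m x y - x| <= lam * `|x - y|
    & `|m x y - y| <= lam * `|x - y|] by exact: (fP (x, y)).
move=> x y Sx Sy; exists (bisect m x y); split.
  exact: (@bisect_continuous _ _ S lam).
split; first exact: bisect0.
split; first exact: (@bisect1 _ _ S lam).
by move=> _ [t _ <-]; exact: (@bisect_in _ _ S lam).
Qed.

(** * Bounds on the modulus of convexity *)

Section ModulusOfConvexity.
Context {R : realType} {E : normedModType R}.
Implicit Types x y z u v : E.

Lemma norm_midp_le x y (r : R) : `|x| <= r -> `|y| <= r -> `|midp x y| <= r.
Proof.
move=> xr yr; rewrite /midp normrZ gtr0_norm ?invr_gt0//.
by have := ler_normD x y; lra.
Qed.

Lemma midp_scale_add (a b : R) z x y :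
  midp (a *: z + b *: x) (a *: z + b *: y) = a *: z + b *: midp x y.
Proof.
rewrite -[in RHS](midpxx (a *: z)) /midp addrACA -(scalerDr b) (scalerDr 2^-1).
by rewrite !scalerA [2^-1 * b]mulrC.
Qed.

Lemma polar_form x : (exists e : E, `|e| = 1) -> exists2 u, `|u| = 1 & x = `|x| *: u.
Proof.
move=> [e e1]; have [->|x0] := eqVneq x 0; first by exists e; rewrite ?normr0 ?scale0r.
have nx0 : `|x| != 0 by rewrite normr_eq0.
exists (`|x|^-1 *: x); last by rewrite scalerA mulfV// scale1r.
by rewrite normrZ normfV normr_id mulVf.
Qed.

Let dels (eps : R) := [set del : R | 0 <= del /\
  forall x1 x2 : E, x1 \in cball 0 1 -> x2 \in cball 0 1 ->
    `|x1 - x2| = eps -> cball (midp x1 x2) del `<=` cball 0 1].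

Lemma dels0 (eps : R) : dels eps 0.
Proof.
split=> // x1 x2; rewrite !inE /cball /= !subr0 => x11 x21 _ z /=.
by rewrite subr0 normr_le0 subr_eq0 => /eqP ->; exact: norm_midp_le.
Qed.

Lemma modconv_le x y (eps : R) : (exists e : E, `|e| = 1) ->
  `|x| <= 1 -> `|y| <= 1 -> 0 <= eps <= `|x - y| ->
  modconv (E := E) eps <= 1 - `|midp x y|.
Proof.
move=> e1 x1 y1 /andP[eps0 epsxy]; set r := eps / `|x - y|.
have [r0 r1] : 0 <= r /\ r <= 1.
  split; first by rewrite divr_ge0.
  have [d0|d0] := eqVneq `|x - y| 0; first by rewrite /r d0 invr0 mulr0.
  by rewrite ler_pdivrMr ?mul1r// lt_neqAle eq_sym d0 normr_ge0.
have rE : r * `|x - y| = eps.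
  have [d0|d0] := eqVneq `|x - y| 0; last by rewrite /r mulfVK.
  by move: epsxy; rewrite d0 mulr0 => ?; apply/eqP; rewrite eq_le eps0.
(* Shrinking [x, y] about its midpoint to length [eps] keeps the midpoint. *)
pose w z := (1 - r) *: midp x y + r *: z.
have w1 z : `|z| <= 1 -> `|w z| <= 1.
  move=> z1; apply: le_trans (ler_normD _ _) _.
  rewrite (normrZ (1 - r)) (normrZ r) !ger0_norm ?subr_ge0//.
  rewrite -[leRHS](subrK r); apply: lerD; apply: ler_piMr; rewrite ?subr_ge0//.
  exact: norm_midp_le.
have wd : `|w x - w y| = eps.
  by rewrite /w opprD addrACA subrr add0r -scalerBr normrZ ger0_norm.
have wm : midp (w x) (w y) = midp x y.
  by rewrite midp_scale_add -scalerDl subrK scale1r.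
apply: ge_sup; first by exists 0; exact: dels0.
move=> del [del0 /(_ (w x) (w y))]; rewrite !inE /cball /= !subr0 wm.
move=> /(_ (w1 _ x1) (w1 _ y1) wd) sub.
(* The midpoint pushed outwards by [del] along its own direction stays in the unit ball. The unit
   vector in the hypothesis supplies a direction when the midpoint is 0. *)
have [u u1 uE] := polar_form (midp x y) e1.
have := sub (midp x y + del *: u); rewrite /= addrAC subrr add0r normrZ u1 ger0_norm//.
rewrite mulr1 lexx => /(_ isT); rewrite subr0 {1}uE -scalerDl normrZ u1 mulr1.
by rewrite ger0_norm ?addr_ge0//; lra.
Qed.

(* The ball of radius [d1] is the intersection of the balls of radius [d]
   centred at distance at most [d - d1], so it inherits their convexity. *)
Lemma cball_near_midp (d d1 g : R) x x1 x2 z : 0 < d1 < d ->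
  cball x d1 x1 -> cball x d1 x2 ->
  0 <= g < d * modconv (E := E) (`|x1 - x2| / d) ->
  `|z - midp x1 x2| <= g -> cball x d1 z.
Proof.
rewrite /cball /= => /andP[d10 d1d] x1d x2d /andP[g0 gd] zg.
have d0 : 0 < d by exact: lt_trans d1d.
have [zx|zx] := eqVneq (z - x) 0; first by rewrite zx normr0 ltW.
have [u u1 uE] : exists2 u, `|u| = 1 & z - x = `|z - x| *: u.
  apply: polar_form; exists (`|z - x|^-1 *: (z - x)).
  by rewrite normrZ normfV normr_id mulVf// normr_eq0.
have [||del [del0 delP] gdel] := @sup_gt _ (dels (`|x1 - x2| / d)) (g / d).
- by exists 0; exact: dels0.
- by rewrite ltr_pdivrMr// mulrC.
(* [w] carries to the unit ball the ball of radius [d] whose centre is shifted from [x] by [d - d1]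
   away from [z]; this is the one that constrains [z] most. *)
pose w y := d^-1 *: (y - x + (d - d1) *: u).
have wB y y' : w y - w y' = d^-1 *: (y - y').
  by rewrite /w -scalerBr opprD addrACA subrr addr0 opprB addrA subrK.
have w1 y : `|y - x| <= d1 -> `|w y| <= 1.
  move=> yd; rewrite /w normrZ gtr0_norm ?invr_gt0// ler_pdivrMl// mulr1.
  apply: le_trans (ler_normD _ _) _; rewrite normrZ u1 mulr1 ger0_norm; lra.
have := delP (w x1) (w x2); rewrite !inE /cball /= !subr0.
move=> /(_ (w1 _ x1d) (w1 _ x2d)); rewrite wB normrZ gtr0_norm ?invr_gt0// mulrC.
move=> /(_ erefl (w z)); rewrite /= subr0 sub_midp !wB.
rewrite !(scalerA 2^-1) [2^-1 / d]mulrC -!(scalerA d^-1).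
rewrite -scalerDr -sub_midp normrZ gtr0_norm ?invr_gt0// mulrC.
have -> : `|z - midp x1 x2| / d <= del.
  by apply: le_trans (ltW gdel); rewrite ler_pM2r ?invr_gt0.
move=> /(_ isT); rewrite /w {1}uE -scalerDl normrZ gtr0_norm ?invr_gt0//.
rewrite normrZ u1 mulr1 ler_pdivrMl// mulr1 ger0_norm; first by lra.
by have := normr_ge0 (z - x); lra.
Qed.

(** Otherwise the slope would gain more than [2 * h] over [M] steps, although it stays between [-h]
    and [h]. *)
Lemma small_second_difference (u : nat -> R) (h : R) (M : nat) : (0 < M)%N ->
  (forall k, `|u k.+1 - u k| <= h) ->
  exists2 k, (k < M)%N & u k.+2 + u k - 2 * u k.+1 <= 2 * h / M%:R.
Proof.
move=> M0 uh; apply: contrapT => nex.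
have big k : (k < M)%N -> 2 * h / M%:R < u k.+2 + u k - 2 * u k.+1.
  by move=> kM; rewrite ltNge; apply/negP => le; apply: nex; exists k.
have slope k : (k < M)%N -> u 1%N - u 0%N + k.+1%:R * (2 * h / M%:R) < u k.+2 - u k.+1.
  elim: k => [|k IHk] kM; first by have := big _ kM; lra.
  have := IHk (ltnW kM); have := big _ kM.
  by rewrite -[in k.+2%:R]addn1 natrD mulrDl mul1r; lra.
have := slope M.-1; rewrite prednK// leqnn => /(_ isT).
have -> : M%:R * (2 * h / M%:R) = 2 * h.
  by rewrite mulrC mulfVK// pnatr_eq0 -lt0n.
have := uh 0%N; have := uh M; rewrite !ler_norml; lra.
Qed.

(** Quantitative independence: [K] bounds from below the distance of [y] from the line of [v], so
    the norm of a combination controls both coefficients. *)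
Lemma norm_comb_lower_bound (y v : E) (K : R) (a b : R) : `|v| = 1 -> 0 < K ->
  (forall t, K <= `|y + t *: v|) ->
  `|a| <= (1 + `|y| / K) * `|b *: y + a *: v| /\ K * `|b| <= `|b *: y + a *: v|.
Proof.
move=> v1 K0 yK.
have Kb : K * `|b| <= `|b *: y + a *: v|.
  have [->|b0] := eqVneq b 0; first by rewrite normr0 mulr0.
  have -> : b *: y + a *: v = b *: (y + (a / b) *: v).
    by rewrite scalerDr scalerA mulrC mulfVK.
  by rewrite normrZ mulrC ler_wpM2l.
split=> //.
have : `|a| <= `|b *: y + a *: v| + `|b| * `|y|.
  rewrite -[`|a|]mulr1 -v1 -!normrZ -{1}[a *: v](addKr (b *: y)) addrC.
  exact: ler_normB.
suff : `|b| * `|y| <= `|y| / K * `|b *: y + a *: v| by lra.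
rewrite mulrC -mulrA ler_wpM2l// mulrC ler_pdivlMr//; lra.
Qed.

(** Splitting off [K *: (u1 + u2)] leaves a remainder of norm at most [P + Q - 2 * K]. *)
Lemma convex_defect_normalized (u1 u2 : E) (K P Q : R) : `|u1| = 1 -> `|u2| = 1 ->
  0 <= K -> K <= P -> K <= Q ->
  2 * K * (1 - `|midp u1 u2|) <= P + Q - `|P *: u1 + Q *: u2|.
Proof.
move=> u11 u21 K0 KP KQ.
have -> : P *: u1 + Q *: u2 = ((P - K) *: u1 + (Q - K) *: u2) + (2 * K) *: midp u1 u2.
  rewrite /midp scalerA mulrAC divff// mul1r scalerDr addrACA -!scalerDl.
  by rewrite !subrK.
have := ler_normD ((P - K) *: u1 + (Q - K) *: u2) ((2 * K) *: midp u1 u2).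
have := ler_normD ((P - K) *: u1) ((Q - K) *: u2).
by rewrite !normrZ u11 u21 !ger0_norm ?subr_ge0 ?mulr_ge0//; lra.
Qed.

(** Some three equally spaced points of the line [y + t *: v] have a small second difference of
    norms. Normalising the outer two gives unit vectors with midpoint near the sphere, and
    independence keeps them at least [eps] apart. *)
Lemma modconv_small (y v : E) (K : R) : `|v| = 1 -> 0 < K ->
  (forall t, K <= `|y + t *: v|) ->
  exists2 e0 : R, 0 < e0 &
    forall eps, 0 < eps <= e0 -> modconv (E := E) eps <= eps / 4.
Proof.
move=> v1 K0 yK.
pose B := `|y| + 2; have B0 : 0 < B by rewrite /B; have := normr_ge0 y; lra.
(* [h <= L * |u1 - u2|] for the unit vectors [u1], [u2] built below from the step [h]. *)
pose L := B / 2 * (1 + `|y| / K + K^-1).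
have L0 : 0 < L.
  rewrite /L mulr_gt0 ?divr_gt0// ltr_wpDl ?invr_gt0//.
  by rewrite addr_ge0// divr_ge0// ltW.
(* Large enough that [h / (M * K) <= eps / 4] for the step [h = L * eps]. *)
pose M := (Num.truncn (4 * L / K)).+1.
have MK : 4 * L <= M%:R * K.
  by rewrite -ler_pdivrMr// ltW// truncnS_gt.
have M0 : 0 < M%:R :> R by rewrite ltr0n.
(* This threshold ensures [M * h <= 1], so the points used have parameter at most 2 and norm at most
   [B]. *)
exists (M%:R * L)^-1; first by rewrite invr_gt0 mulr_gt0.
move=> eps /andP[eps0 epsle]; pose h := L * eps.
have h0 : 0 < h by rewrite mulr_gt0.
have Mh : M%:R * h <= 1.
  have ML0 : 0 < M%:R * L by rewrite mulr_gt0.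
  rewrite /h mulrA; apply: le_trans (ler_wpM2l (ltW ML0) epsle) _.
  by rewrite mulfV ?gt_eqF.
pose phi (k : nat) := `|y + (k%:R * h) *: v|.
have [//|k|k kM kh] := @small_second_difference phi h M.
  rewrite /phi; apply: le_trans (ler_dist_dist _ _) _.
  rewrite opprD addrACA subrr add0r -scalerBl -mulrBl -natrB// subSnn mul1r.
  by rewrite normrZ v1 mulr1 gtr0_norm.
pose t := k.+1%:R * h; pose p := y + (t + h) *: v; pose q := y + (t - h) *: v.
have [t0 t1] : 0 <= t /\ t <= 1.
  split; first by rewrite mulr_ge0// ltW.
  by apply: le_trans Mh; rewrite ler_pM2r// ler_nat.
have ht : h <= t by rewrite /t -[leLHS]mul1r ler_pM2r// ler1n.
have pB : `|p| <= B.
  apply: le_trans (ler_normD _ _) _; rewrite normrZ v1 mulr1 ger0_norm /B; lra.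
have qB : `|q| <= B.
  apply: le_trans (ler_normD _ _) _; rewrite normrZ v1 mulr1 ger0_norm /B; lra.
have pK : K <= `|p| by exact: yK.
have qK : K <= `|q| by exact: yK.
have p0 : 0 < `|p| by exact: lt_le_trans pK.
have q0 : 0 < `|q| by exact: lt_le_trans qK.
have pqE : `|p| + `|q| - `|p + q| <= 2 * h / M%:R.
  have -> : p + q = 2 *: (y + t *: v).
    rewrite /p /q addrACA -scalerDl scalerDr scalerA scaler_nat mulr2n.
    by congr (_ + _ *: _); lra.
  move: kh; rewrite normrZ ger0_norm// /phi.
  have -> : k.+2%:R * h = t + h by rewrite /t -[in LHS]addn1 natrD mulrDl mul1r.
  have -> : k%:R * h = t - h by rewrite /t -[in RHS]addn1 natrD mulrDl mul1r addrK.
  by [].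
pose u1 := `|p|^-1 *: p; pose u2 := `|q|^-1 *: q.
have u11 : `|u1| = 1 by rewrite normrZ normfV normr_id mulVf// gt_eqF.
have u21 : `|u2| = 1 by rewrite normrZ normfV normr_id mulVf// gt_eqF.
have mid : 1 - `|midp u1 u2| <= eps / 4.
  have := convex_defect_normalized u1 u2 K `|p| `|q| u11 u21 (ltW K0) pK qK.
  rewrite !scalerA !mulfV ?gt_eqF// !scale1r => /le_trans/(_ pqE).
  have -> : 2 * h / M%:R = 2 * K * (h / (M%:R * K)) by field; rewrite !gt_eqF.
  rewrite ler_pM2l ?mulr_gt0// => /le_trans; apply.
  rewrite ler_pdivrMr ?mulr_gt0// /h; by have := ler_wpM2r (ltW eps0) MK; lra.
apply: le_trans mid; apply: modconv_le; [by exists v|by rewrite u11|by rewrite u21|].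
rewrite (ltW eps0) /=.
(* The coefficients of [u1 - u2] cannot both be small, since [c >= 2 / B] and [t <= 1]. *)
pose b := `|p|^-1 - `|q|^-1; pose c := `|p|^-1 + `|q|^-1.
have -> : u1 - u2 = b *: y + (t * b + h * c) *: v.
  rewrite /u1 /u2 /p /q !scalerDr !scalerA opprD addrACA -scalerBl -scalerBl.
  by congr (_ + _ *: _); rewrite /b /c; ring.
have [aN bN] := norm_comb_lower_bound y v K (t * b + h * c) b v1 K0 yK.
move: aN bN; set n := `|b *: y + _|; set a := t * b + _ => aN bN.
have cB : 2 / B <= c.
  have : B^-1 <= `|p|^-1 by rewrite lef_pV2 ?posrE.
  have : B^-1 <= `|q|^-1 by rewrite lef_pV2 ?posrE.
  by rewrite /c; lra.
have hc : h * (2 / B) <= h * c by rewrite ler_pM2l.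
have aL : h * (2 / B) <= `|a| + `|b|.
  have := ler_norm a; have := ler_norm (- (t * b)).
  have : t * `|b| <= `|b| by rewrite ler_piMl.
  by rewrite normrN normrM (ger0_norm t0) /a; lra.
have bK : `|b| <= K^-1 * n by rewrite ler_pdivlMl.
have : h * (2 / B) <= (1 + `|y| / K + K^-1) * n by lra.
rewrite mulrA ler_pdivrMr// => hn.
rewrite -(ler_pM2l L0) -/h /L; lra.
Qed.

End ModulusOfConvexity.

(** * Dimension one against higher dimension *)

(** If the midpoint were missing, the nearest points of [A] on its two sides would bound a gap
    shorter than [D], and the point given by the hypothesis would lie strictly inside it. *)
Lemma midp_in_of_dim1 {R : realType} {E : normedModType R} (A : set E) (D : R) :
  closed A ->
  (forall y v : E, `|v| = 1 -> exists t : R, y + t *: v = 0) ->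
  (forall x y, A x -> A y -> 0 < `|x - y| < D ->
     exists2 z, A z & `|z - midp x y| < `|x - y| / 2) ->
  forall x y, A x -> A y -> `|x - y| < D -> A (midp x y).
Proof.
move=> clA dim1 Amid x y Ax Ay xyD.
have [<-|yx] := eqVneq x y; first by rewrite midpxx.
pose L := `|y - x|; have L0 : 0 < L by rewrite normr_gt0 subr_eq0 eq_sym.
pose v := L^-1 *: (y - x).
have v1 : `|v| = 1 by rewrite normrZ gtr0_norm ?invr_gt0// mulVf// gt_eqF.
pose phi (t : R) := x + t *: v.
have phiB s t : phi s - phi t = (s - t) *: v.
  by rewrite /phi opprD addrACA subrr add0r scalerBl.
have phi_mid s t : midp (phi s) (phi t) = phi ((s + t) / 2).
  rewrite /midp /phi addrACA -scalerDl scalerDr scalerA [_ * 2^-1]mulrC.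
  by rewrite -[X in X + _ = _]/(midp x x) midpxx.
have phi0 : phi 0 = x by rewrite /phi scale0r addr0.
have phiL : phi L = y by rewrite /phi /v scalerA mulfV ?gt_eqF// scale1r subrKC.
(* One-dimensionality enters here: [phi] parametrises all of [E]. *)
have phi_surj z : exists t, z = phi t.
  have [t zt] := dim1 (z - x) v v1; exists (- t).
  by rewrite /phi scaleNr -[z](subrK x) addrC; congr (_ + _); apply/eqP; rewrite -addr_eq0 zt.
have cphi : continuous phi.
  move=> t; apply: cvgD; first exact: cvg_cst.
  by apply: cvgZr_tmp; exact: cvg_id.
have clT : closed (phi @^-1` A) by exact: (continuous_closedP _).1.
pose T0 := phi @^-1` A `&` [set t | t <= L / 2].
pose T1 := phi @^-1` A `&` [set t | L / 2 <= t].
have T00 : T0 0 by split; rewrite /= ?phi0//; lra.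
have T1L : T1 L by split; rewrite /= ?phiL//; lra.
have ubT0 : ubound T0 (L / 2) by move=> t [].
have lbT1 : lbound T1 (L / 2) by move=> t [].
have supT0 : has_sup T0 by split; [exists 0|exists (L / 2)].
have infT1 : has_inf T1 by split; [exists L|exists (L / 2)].
have [Aa aL] : T0 (sup T0).
  apply: (itv_closed_supremums (A := T0)); first by exists 0.
    by apply: closedI => //; exact: closed_le.
  by split; [exact: ub_le_sup supT0.2|move=> t; exact: ge_sup supT0.1].
have [Ab bL] : T1 (inf T1).
  apply: (itv_closed_infimums (A := T1)); first by exists L.
    by apply: closedI => //; exact: closed_ge.
  by split; [exact: ge_inf infT1.2|move=> t; exact: lb_le_inf infT1.1].
have a0 : 0 <= sup T0 by exact: ub_le_sup supT0.2 _ T00.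
have bL1 : inf T1 <= L by exact: ge_inf infT1.2 _ T1L.
have below t : A (phi t) -> t <= L / 2 -> t <= sup T0.
  by move=> At tL; exact: ub_le_sup supT0.2 _ (conj At tL).
have above t : A (phi t) -> L / 2 <= t -> inf T1 <= t.
  by move=> At tL; exact: ge_inf infT1.2 _ (conj At tL).
move: (sup T0) (inf T1) Aa aL Ab bL a0 bL1 below above.
move=> a b /= Aa aL Ab bL a0 bL1 below above.
rewrite -phi0 -phiL phi_mid add0r.
have [ab|ab] := leP b a; first by have -> : L / 2 = a by lra.
have abE : `|phi a - phi b| = b - a.
  by rewrite phiB normrZ v1 mulr1 distrC gtr0_norm ?subr_gt0.
have LD : L < D by rewrite /L distrC.
have [|z Az] := Amid _ _ Aa Ab; first by rewrite abE; lra.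
have [c cE] := phi_surj z.
rewrite abE phi_mid cE phiB normrZ v1 mulr1 ltr_norml => cab.
rewrite cE in Az; have [cL|/ltW cL] := leP c (L / 2).
  by have := below _ Az cL; lra.
by have := above _ Az cL; lra.
Qed.

Lemma dim1_or_independent {R : realType} (E : normedModType R) :
  (forall y v : E, `|v| = 1 -> exists t : R, y + t *: v = 0) \/
  exists y v : E, `|v| = 1 /\ exists2 K : R, 0 < K & forall t, K <= `|y + t *: v|.
Proof.
have [|/existsNP[y /existsNP[v /not_implyP[v1 ind]]]] :=
  pselect (forall y v : E, `|v| = 1 -> exists t : R, y + t *: v = 0); first by left.
right; exists y, v; split => //.
have y0 : 0 < `|y|.
  rewrite normr_gt0; apply/eqP => y0; apply: ind; exists 0.
  by rewrite y0 scale0r addr0.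
(* For [t] beyond [r] in absolute value the norm exceeds [|y|], so only a compact interval needs the
   minimum. *)
pose r := 2 * `|y|; have r0 : - r <= r by rewrite /r; lra.
have cf : continuous (fun t : R => `|y + t *: v|).
  move=> t; apply: cvg_norm; apply: cvgD; first exact: cvg_cst.
  by apply: cvgZr_tmp; exact: cvg_id.
have [c _ cmin] := EVT_min r0 (continuous_subspaceT cf).
have c0 : 0 < `|y + c *: v|.
  by rewrite normr_gt0; apply/eqP => c0; apply: ind; exists c.
exists (Num.min `|y + c *: v| `|y|); first by rewrite lt_min c0.
move=> t; rewrite ge_min; have [tr|tr] := leP `|t| r.
  by apply/orP; left; apply: cmin; rewrite in_itv /= -ler_norml.
apply/orP; right.
have := lerB_dist (t *: v) (- y); rewrite normrN normrZ v1 mulr1 opprK [t *: v + y]addrC.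
by rewrite /r in tr; lra.
Qed.

(** * A uniform contraction ratio *)

Section UniformMidpoints.
Context {R : realType} {E : normedModType R}.

Definition has_midpoints (S : set E) (r lam : R) := forall x y, S x -> S y ->
  `|x - y| <= r -> exists m,
    [/\ S m, `|m - x| <= lam * `|x - y| & `|m - y| <= lam * `|x - y|].

(* Right continuity of [gammaS] pushes a contraction ratio valid up to distance
   [r] slightly beyond [r]. *)
Lemma weakly_convex_has_midpoints (S : set E) (D b e0 l0 : R) :
  weakly_convex_on S D -> b < D -> 0 < e0 -> 0 <= l0 < 1 ->
  has_midpoints S e0 l0 -> exists2 lam, 0 <= lam < 1 & has_midpoints S b lam.
Proof.
move=> wS bD e0_gt0 l0P S0; apply: contrapT => nb.
pose Q := [set r | exists2 lam, 0 <= lam < 1 & has_midpoints S r lam].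
have Qe0 : Q e0 by exists l0.
have Qb : ubound Q b.
  move=> r [l lP Sl]; rewrite leNgt; apply/negP => br; apply: nb; exists l => //.
  by move=> x y Sx Sy xy; apply: Sl => //; exact: le_trans (ltW br).
have supQ : has_sup Q by split; [exists e0|exists b].
have r0 : e0 <= sup Q by exact: ub_le_sup supQ.2 _ Qe0.
have rb : sup Q <= b by exact: ge_sup supQ.1 Qb.
have := ub_le_sup supQ.2; have := @sup_gt _ Q ^~ supQ.1.
move: (sup Q) r0 rb => r r0 rb Qgt Qle.
have gr : gammaS S r < r / 2 by apply: wS; lra.
have [g gE] : exists g, g = (gammaS S r + r / 2) / 2 by eexists.
have [|||r' rr' gr'] := @gammaS_ltP _ _ S r g (r / 2 - g).
- by rewrite gt_eqF//; lra.
- by lra.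
- by lra.
(* [k] bounds the distance from an approximate midpoint to the endpoints; the slack [r / 2 - g]
   allowed to [r'] makes [k < r]. *)
pose k := r' / 2 + g.
have kr : k < r by rewrite /k; lra.
(* Pairs up to [r1] use the ratio [l1]; for longer pairs, [k] is at most [k / r1] times their
   distance. *)
have [r1 [l1 l1P Sl1] kr1] := Qgt _ kr.
have k0 : 0 <= k by have := gamma0_ge0 S r'; rewrite /k; lra.
have r10 : 0 < r1 by lra.
have kr1P : 0 <= k / r1 < 1.
  by rewrite ltr_pdivrMr// mul1r kr1 divr_ge0// ltW.
suff /Qle : Q r' by lra.
exists (Num.max l1 (k / r1)); first by rewrite le_max gt_max; lra.
move=> x y Sx Sy xy; have [xr1|xr1] := leP `|x - y| r1.
  have [m [Sm mx my]] := Sl1 _ _ Sx Sy xr1.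
  have l1le : l1 * `|x - y| <= Num.max l1 (k / r1) * `|x - y|.
    by rewrite ler_wpM2r// le_max lexx.
  by exists m; split => //; exact: le_trans l1le.
have [z Sz zg] := gamma0_ltP S r' g x y gr' Sx Sy xy.
have [zx zy] := dist_near_midp x y z g zg.
have kle : k <= Num.max l1 (k / r1) * `|x - y|.
  apply: (@le_trans _ _ (k / r1 * r1)); first by rewrite divfK// gt_eqF.
  by apply: ler_pM; rewrite ?divr_ge0 ?le_max ?lexx ?orbT//; lra.
by exists z; split => //; apply: le_trans kle; rewrite /k; lra.
Qed.

End UniformMidpoints.

(** * Intersection with a ball *)

Section Intersection.
Context {R : realType} {E : normedModType R}.
Variables (d d1 : R) (A : set E) (x : E).
Hypothesis d1d : 0 < d1 < d.
Hypothesis gammaA : forall eps : R, 0 < eps < 2 * d ->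
  gammaS A eps < d * modconv (E := E) (eps / d).

Local Notation S := (A `&` cball x d1).

Lemma dist_cball y z : cball x d1 y -> cball x d1 z -> `|y - z| <= 2 * d1.
Proof.
rewrite /cball /= => yx zx; have := ler_distD x y z.
by rewrite (distrC x z); lra.
Qed.

(** A radius below the convexity bound keeps the given point in the ball. A larger radius is
    replaced by one between [gammaS A] and that bound. The bound by [g] compares moduli; the other
    yields the contraction ratio. *)
Lemma near_midp_intersection (g : R) y z : S y -> S z -> 0 <= g ->
  cball (midp y z) g `&` A !=set0 ->
  exists2 w, S w & `|w - midp y z| <= g /\
    (y != z -> `|w - midp y z| <= d * modconv (E := E) (`|y - z| / d)).
Proof.
move=> [Ay yx] [Az zx] g0 [w [wg Aw]].
have [<-|yz] := eqVneq y z.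
  by exists y => //; rewrite midpxx subrr normr0; split.
have yz0 : 0 < `|y - z| by rewrite normr_gt0 subr_eq0.
have yzd := dist_cball _ _ yx zx.
have gd : gammaS A `|y - z| < d * modconv (E := E) (`|y - z| / d).
  by apply: gammaA; move/andP: d1d => [_ ?]; rewrite yz0 /=; lra.
have ge_g0 := gamma0_ge0 A `|y - z|.
have le_g0 := gamma0_le_gammaS A `|y - z| (lt0r_neq0 yz0).
have [gs|gs] := ltP g (d * modconv (E := E) (`|y - z| / d)).
  exists w; last by split => // _; exact: le_trans (ltW gs).
  split => //; apply: (cball_near_midp d d1 g x y z w) => //.
  by rewrite g0.
have [w' Aw' w'g] := gamma0_ltP A `|y - z|
  ((gammaS A `|y - z| + d * modconv (E := E) (`|y - z| / d)) / 2) y z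
  ltac:(lra) Ay Az (lexx _).
exists w'; last by split; [|move=> _]; lra.
split => //; apply: (cball_near_midp d d1 _ x y z w' d1d yx zx _ w'g); lra.
Qed.

Lemma gammaS_intersection (eps : R) : gammaS S eps <= gammaS A eps.
Proof.
apply: gammaS_le => t; apply: gamma0_le => g y z g0 [Ay yx] [Az zx] yz /(_ _ _ Ay Az yz) gA.
have [w Sw [wg _]] := near_midp_intersection g y z (conj Ay yx) (conj Az zx) (ltW g0) gA.
by exists w.
Qed.

Lemma closed_intersection : closed A -> closed S.
Proof.
move=> clA; apply: closedI => //.
have cf : continuous (fun y : E => `|y - x|).
  by move=> y; apply: cvg_norm; apply: cvgB; [exact: cvg_id|exact: cvg_cst].
have -> : cball x d1 = (fun y : E => `|y - x|) @^-1` [set t | t <= d1] by [].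
by apply: ((continuous_closedP _).1 cf); exact: closed_le.
Qed.

Lemma intersection_has_midpoints : closed A -> weakly_convex_on A (2 * d) ->
  exists2 lam : R, 0 <= lam < 1 & has_midpoints S (2 * d1) lam.
Proof.
move=> clA wA.
have [d10 d1_lt_d] := andP d1d; have d0 : 0 < d by lra.
have [dim1|[y [v [v1 [K K0 yK]]]]] := dim1_or_independent E.
  exists 2^-1; first by lra.
  move=> y z [Ay yx] [Az zx] yz; exists (midp y z); split; last 2 first.
  - by rewrite distrC distl_midp mulrC.
  - by rewrite distrC distr_midp mulrC.
  split; last first.
    rewrite /cball /= in yx zx *; rewrite distrC sub_midp.
    apply: le_trans (ler_normD _ _) _; rewrite !normrZ gtr0_norm ?invr_gt0//.
    by rewrite (distrC x y) (distrC x z); lra.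
  apply: (midp_in_of_dim1 A (2 * d)) => //; last by lra.
  move=> a b Aa Ab ab; have ab0 : `|a - b| != 0 by rewrite gt_eqF//; lra.
  have lt : gamma0 A `|a - b| < `|a - b| / 2.
    by apply: le_lt_trans (wA _ ab); exact: gamma0_le_gammaS.
  have [w Aw wab] := gamma0_ltP A `|a - b| ((gamma0 A `|a - b| + `|a - b| / 2) / 2) a b
    ltac:(lra) Aa Ab (lexx _).
  by exists w => //; lra.
have [e0 e00 small] := modconv_small y v K v1 K0 yK.
(* At scales up to [d * e0] the convexity bound is at most a quarter of the distance, and 1/2 + 1/4
   = 3/4. *)
apply: (@weakly_convex_has_midpoints _ _ S (2 * d) _ (d * e0) (3 / 4)).
- move=> eps epsd; apply: le_lt_trans (gammaS_intersection eps) _; exact: wA.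
- by lra.
- by rewrite mulr_gt0.
- by lra.
move=> a b Sa Sb ab.
(* The endpoint [a] itself meets the radius [|a - b| / 2]; for [a != b] the useful output is the
   second bound. *)
have [w Sw [wg wm]] := near_midp_intersection (`|a - b| / 2) a b Sa Sb
  ltac:(have := normr_ge0 (a - b); lra)
  (ex_intro _ a (conj (eq_ind_r (fun t => is_true (t <= _)) (lexx _) (distl_midp a b)) Sa.1)).
exists w; suff : `|w - midp a b| <= `|a - b| / 4.
  by move=> /dist_near_midp[wa wb]; split => //; lra.
have [abE|abE] := eqVneq a b.
  by move: wg; rewrite abE subrr normr0; lra.
apply: le_trans (wm abE) _; rewrite -ler_pdivlMl//.
rewrite mulrCA mulrA; apply: small; rewrite divr_gt0 ?normr_gt0 ?subr_eq0//=.
by rewrite ler_pdivrMr// mulrC.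
Qed.

End Intersection.

(** * Weak convexity and path connectedness of the intersection *)

Theorem theorem3p3 (R : realType) (E : completeNormedModType R) (d d1 : R)
  (A : set E) :
  unif_convex (E := E) -> 0 < d ->
  closed A ->
  weakly_convex_on A (2 * d) ->
  (forall eps : R, 0 < eps < 2 * d -> gammaS A eps < d * modconv (E := E) (eps / d)) ->
  condition_i (fun t => d * modconv (E := E) (t / d)) (gammaS A) (2 * d) ->
  0 < d1 < d ->
  forall x : E, A `&` cball x d1 !=set0 ->
    weakly_convex_on (A `&` cball x d1) (diam (A `&` cball x d1)) /\
    (forall eps : R, 0 <= eps < diam (A `&` cball x d1) ->
       gammaS (A `&` cball x d1) eps <= gammaS A eps) /\
    path_connected_set (A `&` cball x d1).
Proof.
move=> _ _ clA wA gammaA _ d1d x S0; split; last split.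
- move=> eps epsd; apply: le_lt_trans (gammaS_intersection d d1 A x d1d gammaA eps) _.
  (* The diameter is at most [2 * d1 < 2 * d], within the range where [A] is weakly convex. *)
  apply: wA; suff : diam (A `&` cball x d1) <= 2 * d1 by lra.
  by apply: diam_le => // y z [_ yx] [_ zx]; exact: dist_cball yx zx.
- by move=> eps _; exact: gammaS_intersection d d1 A x d1d gammaA eps.
have [lam lamP Sm] := intersection_has_midpoints d d1 A x d1d gammaA clA wA.
apply: (midpoints_path_connected _ lam) => //; first exact: closed_intersection.
by move=> y z Sy Sz; apply: Sm => //; exact: dist_cball Sy.2 Sz.2.
Qed.
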